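(* Let $T\rtimes R$ be a semidirect product of finite $2$-groups with $T$ normal and $R$ abelian, write $TR=T\rtimes R$, let $n\ge1$, and let $S(T,R,J)$ be the associated group of $n\times n$ monomial matrices over $TR$ (defined in the context). Then $r_2(S(T,R,J))\le n\cdot r_2(TR)$. Suppose that $r_2(T)=r_2(TR)$. Then $r_2(S(T,R,J))=n\cdot r_2(T)$.
   Context: For a finite $2$-group $P$, $r_2(P)$ is the maximal dimension over $\mathbb Z_2$ of an elementary abelian subgroup of $P$. Matrices below are monomial matrices with nonzero entries in the group $TR$, multiplied in the usual way. For $r\in R$ let $d_k(r)$ be the $2^k\times2^k$ diagonal matrix $\mathrm{diag}(r,1,\dots,1)$, and $d_0(r)=(r)$. Define $w_0(T,R,J)=T$ and, inductively, let $w_{k+1}(T,R,J)$ be the group of $2^{k+1}\times2^{k+1}$ matrices generated by all $\mathrm{diag}(a,I_{2^k})$ and $\mathrm{diag}(I_{2^k},a)$ with $a\in w_k(T,R,J)$, all $\mathrm{diag}(d_k(r),d_k(r)^{-1})$ with $r\in R$, and the permutation matrix $\begin{pmatrix}0&I_{2^k}\\ I_{2^k}&0\end{pmatrix}$. Let $n=2^{m_1}+2^{m_2}+\cdots+2^{m_u}$, $m_1<m_2<\cdots<m_u$, be the $2$-adic representation of $n$. Let $W(T,R,J)$ be the group of $n\times n$ block diagonal matrices $\mathrm{diag}(a_1,\dots,a_u)$ with $a_i\in w_{m_i}(T,R,J)$. Let $U(R)=1$ if $u=1$; if $u\ge2$, let $U(R)$ be the group generated by the block diagonal matrices, for $r\in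 R$ and $1\le i\le u-1$, whose $i$-th and $(i+1)$-th blocks are $d_{m_i}(r)$ and $d_{m_{i+1}}(r)$ and whose $j$-th block is $I_{2^{m_j}}$ for $j\ne i,i+1$. Then $U(R)$ normalises $W(T,R,J)$ and $S(T,R,J)=W(T,R,J)\rtimes U(R)$.
   Formalization: The formal statement assumes TR is nontrivial when n > 1: for T = R = 1 and n ≥ 2, S(T,R,J) contains a permutation matrix of order 2, so r_2(S(T,R,J)) ≥ 1 > 0 = n·r_2(TR) and both claims fail. *)

(* Defs.v *)
From HB Require Import structures.
From mathcomp Require Import all_boot all_order all_algebra all_fingroup all_solvable.

Set Implicit Arguments.
Unset Strict Implicit.
Unset Printing Implicit Defensive.

Import GroupScope.

(* Matrix entries live in [option gT]: [None] is the zero adjoined to the group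
   [gT], and [Some x] is the group element [x]. *)

Section ZeroAdjoined.

Variable gT : finGroupType.
Implicit Types x y : option gT.

Definition zmul x y : option gT :=
  if x is Some a then if y is Some b then Some (a * b) else None else None.

(* [None] is neutral.  The value at two nonzero entries is immaterial: in a
   product of monomial matrices every sum has exactly one nonzero term. *)
Definition zadd x y : option gT := if x is Some _ then x else y.

End ZeroAdjoined.

Section MonomialGroup.

Variables (gT : finGroupType) (n : nat).
Implicit Types A B : 'M[option gT]_n.

Definition is_monomial A :=
  [forall i, #|[pred j | A i j != None]| == 1%N] &&
  [forall j, #|[pred i | A i j != None]| == 1%N].

Definition mulmon A B : 'M[option gT]_n :=
  \matrix_(i, k) \big[@zadd gT/None]_(j < n) zmul (A i j) (B j k).

Definition diagmon (f : 'I_n -> gT) : 'M[option gT]_n :=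
  \matrix_(i, j) if i == j then Some (f i) else None.

Definition invmon A : 'M[option gT]_n :=
  \matrix_(i, j) omap (fun x => x^-1) (A j i).

Lemma big_zadd_only1 (F : 'I_n -> option gT) (j0 : 'I_n) :
  (forall j, j != j0 -> F j = None) ->
  \big[@zadd gT/None]_(j < n) F j = F j0.
Proof.
move=> F0; have: j0 \in index_enum 'I_n by rewrite mem_index_enum.
elim: (index_enum 'I_n) => [|j s IHs] //; rewrite inE big_cons.
case: (eqVneq j0 j) => [<- _ | ne_j /IHs->]; last by rewrite F0 // eq_sym.
case def_j0: (F j0) => //=; elim: s {IHs} => [|i s IHs]; first by rewrite big_nil.
by rewrite big_cons IHs; case: (eqVneq i j0) => [->|/F0->]; rewrite ?def_j0.
Qed.

Lemma monomialP A :
  reflect (exists2 s : 'I_n -> 'I_n, injective s &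
           exists f, forall i j, A i j = if j == s i then Some (f i) else None)
          (is_monomial A).
Proof.
apply: (iffP andP) => [[/forallP rA /forallP cA] | [s injs [f defA]]]; last first.
  have [s' sK s'K] := injF_bij injs.
  split; apply/forallP=> i; apply/eqP.
    by apply: (@eq_card1 _ (s i)) => j; rewrite !inE defA; case: (j == s i).
  apply: (@eq_card1 _ (s' i)) => j.
  by rewrite !inE defA (eq_sym i) (can2_eq sK s'K); case: (j == _).
have rowA i : {j | forall j', (A i j' != None) = (j' == j)}.
  by have [j defj] := mem_card1 (eqP (rA i)); exists j => j'; apply: defj.
have colA j : {i | forall i', (A i' j != None) = (i' == i)}.
  by have [i defi] := mem_card1 (eqP (cA j)); exists i => i'; apply: defi.
exists (fun i => sval (rowA i)) => [i i' | ].
  case: (rowA i) (rowA i') => j /= jP [j' /= j'P] eq_j; case: (colA j) => k kP.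
  have := kP i; rewrite jP eqxx => /esym/eqP->.
  by have := kP i'; rewrite j'P eq_j eqxx => /esym/eqP->.
exists (fun i => odflt 1 (A i (sval (rowA i)))) => i j.
case: (rowA i) => k /= kP; have := kP j; case: (j =P k) => [-> | _].
  by case: (A i k).
by move/negbFE/eqP.
Qed.

Lemma mulmonP A B s f t g :
  (forall i j, A i j = if j == s i then Some (f i) else None) ->
  (forall i j, B i j = if j == t i then Some (g i) else None) ->
  forall i j, mulmon A B i j =
    if j == t (s i) then Some (f i * g (s i)) else None.
Proof.
move=> defA defB i k; rewrite mxE (@big_zadd_only1 _ (s i)) => [|j /negPf nej].
  by rewrite defA eqxx defB; case: eqP.
by rewrite defA nej.
Qed.

Lemma mulmon_subproof A B :
  is_monomial A -> is_monomial B -> is_monomial (mulmon A B).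
Proof.
case/monomialP=> s injs [f defA] /monomialP[t injt [g defB]].
apply/monomialP; exists (t \o s); first exact: inj_comp.
by exists (fun i => f i * g (s i)) => i j; apply: (mulmonP defA defB).
Qed.

Lemma diagmon_subproof f : is_monomial (diagmon f).
Proof.
by apply/monomialP; exists id => //; exists f => i j; rewrite mxE eq_sym.
Qed.

Lemma invmon_subproof A : is_monomial A -> is_monomial (invmon A).
Proof.
rewrite /is_monomial => /andP[/forallP rA /forallP cA].
by apply/andP; split; apply/forallP=> i;
  [rewrite -(eqP (cA i)) | rewrite -(eqP (rA i))];
  apply/eqP/eq_card=> j; rewrite !inE mxE; case: (A _ _).
Qed.

Record monomial := Monomial {
  mxmon :> 'M[option gT]_n;
  monomial_valP : is_monomial mxmon
}.

HB.instance Definition _ := [isSub for mxmon].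
HB.instance Definition _ := [Finite of monomial by <:].

Definition monM (A B : monomial) :=
  Monomial (mulmon_subproof (valP A) (valP B)).
Definition mon1 := Monomial (diagmon_subproof (fun=> 1)).
Definition monV (A : monomial) := Monomial (invmon_subproof (valP A)).

Lemma monMA : associative monM.
Proof.
move=> A B C; apply/val_inj/matrixP=> i j /=.
have [/monomialP[s _ [f defA]] /monomialP[t _ [g defB]]] := (valP A, valP B).
have /monomialP[v _ [h defC]] := valP C.
rewrite (mulmonP defA (mulmonP defB defC)) (mulmonP (mulmonP defA defB) defC).
by rewrite mulgA.
Qed.

Lemma mon1M : left_id mon1 monM.
Proof.
move=> A; apply/val_inj/matrixP=> i j /=.
have /monomialP[s _ [f defA]] := valP A.
have def1 k l : diagmon (fun=> 1) k l = if l == id k then Some 1 else None.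
  by rewrite mxE eq_sym.
by rewrite (mulmonP def1 defA) mul1g defA.
Qed.

Lemma monVM : left_inverse mon1 monV monM.
Proof.
move=> A; apply/val_inj/matrixP=> i j /=.
have /monomialP[s injs [f defA]] := valP A; have [s' sK s'K] := injF_bij injs.
have defV k l : invmon A k l = if l == s' k then Some (f (s' k))^-1 else None.
  rewrite mxE defA (eq_sym k) (can2_eq sK s'K).
  by case: eqP => //= ->.
by rewrite (mulmonP defV defA) s'K mulVg mxE eq_sym.
Qed.

HB.instance Definition _ := Finite_isGroup.Build monomial monMA mon1M monVM.

Definition dmon (f : 'I_n -> gT) : monomial := Monomial (diagmon_subproof f).

End MonomialGroup.

Section Blocks.

Variable gT : finGroupType.

Let Z m n : 'M[option gT]_(m, n) := const_mx None.

Lemma castmon_subproof n1 n2 (e : n1 = n2) (A : monomial gT n1) :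
  is_monomial (castmx (e, e) (val A)).
Proof. by case: n2 / e; rewrite castmx_id (valP A). Qed.

Definition castmon n1 n2 (e : n1 = n2) (A : monomial gT n1) : monomial gT n2 :=
  Monomial (castmon_subproof e A).

Lemma diag2_subproof n1 n2 (A : monomial gT n1) (B : monomial gT n2) :
  is_monomial (block_mx (val A) (Z n1 n2) (Z n2 n1) (val B)).
Proof.
have [/monomialP[s injs [f defA]] /monomialP[t injt [g defB]]] := (valP A, valP B).
pose st i := match split i with inl j => lshift n2 (s j) | inr j => rshift n1 (t j) end.
apply/monomialP; exists st => [i i' | ].
  rewrite /st; case: (splitP i) => j defi; case: (splitP i') => j' defi';
    move/(congr1 val) => /= eq_j; apply/val_inj; rewrite /= defi defi'.
  - by congr (val _); apply/injs/val_inj.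
  - by have:= ltn_ord (s j); rewrite eq_j ltnNge leq_addr.
  - by have:= ltn_ord (s j'); rewrite -eq_j ltnNge leq_addr.
  - by congr (_ + val _)%N; apply/injt/val_inj/(addnI eq_j).
exists (fun i => match split i with inl j => f j | inr j => g j end) => i j.
by rewrite /st /block_mx; case: (split_ordP i) => {}i ->;
  case: (split_ordP j) => {}j ->;
  rewrite ?(col_mxEu, col_mxEd) ?(row_mxEl, row_mxEr) ?mxE ?defA ?defB
    ?(eq_lshift, eq_rshift, eq_lrshift, eq_rlshift).
Qed.

Definition diag2 n1 n2 (A : monomial gT n1) (B : monomial gT n2) :
  monomial gT (n1 + n2) := Monomial (diag2_subproof A B).

Lemma swap_subproof n :
  is_monomial (block_mx (Z n n) (mxmon 1) (mxmon 1) (Z n n)).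
Proof.
pose s (i : 'I_(n + n)) :=
  match split i with inl j => rshift n j | inr j => lshift n j end.
apply/monomialP; exists s => [i i' | ].
  rewrite /s; case: (splitP i) => j defi; case: (splitP i') => j' defi';
    move/(congr1 val) => /= eq_j; apply/val_inj; rewrite /= defi defi'.
  - exact: addnI eq_j.
  - by have:= ltn_ord j'; rewrite -eq_j ltnNge leq_addr.
  - by have:= ltn_ord j; rewrite eq_j ltnNge leq_addr.
  - by rewrite eq_j.
exists (fun=> 1) => i j.
by rewrite /s /block_mx; case: (split_ordP i) => {}i ->;
  case: (split_ordP j) => {}j ->;
  rewrite ?(col_mxEu, col_mxEd) ?(row_mxEl, row_mxEr) ?mxE
    ?(eq_lshift, eq_rshift, eq_lrshift, eq_rlshift) // eq_sym.
Qed.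

Definition swap n : monomial gT (n + n) := Monomial (swap_subproof n).

Section BlockDiagonal.

Variables (u : nat) (p : 'I_u -> nat) (a : forall i, monomial gT (p i)).

(* [conform_mx] only identifies 'M_(p i, p j) with 'M_(p i, p i) when i = j; its
   default is never used. *)
Definition bdiag_mx : 'M[option gT]_(\sum_i p i) :=
  mxblock (fun i j => if i == j then conform_mx (Z (p i) (p j)) (val (a i))
                      else Z (p i) (p j)).

Lemma bdiag_subproof : is_monomial bdiag_mx.
Proof.
have: forall i, exists sf : ('I_(p i) -> 'I_(p i)) * ('I_(p i) -> gT),
    injective sf.1 /\
    forall k l, val (a i) k l = if l == sf.1 k then Some (sf.2 k) else None.
  by move=> i; have /monomialP[s ? [f ?]] := valP (a i); exists (s, f).
case/fin_all_exists=> sf sfP.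
pose s (x : {i & 'I_(p i)}) := Tagged (fun i => 'I_(p i)) ((sf (tag x)).1 (tagged x)).
have injs : injective s.
  case=> i k [i' k'] /eqP; rewrite /s -tag_eqE /tag_eq /=.
  case: eqP => //= eq_i; case: i' / eq_i in k' *.
  by rewrite tagged_asE => /eqP/(proj1 (sfP i))->.
apply/monomialP; exists (tagnat.rank \o s \o tagnat.sig).
  exact: inj_comp (inj_comp tagnat.rank_inj injs) tagnat.sig_inj.
exists (fun x => (sf (tagnat.sig1 x)).2 (tagnat.sig2 x)) => x y.
rewrite -[y]tagnat.sigK (inj_eq tagnat.rank_inj) mxE.
rewrite /tagnat.sig1 /tagnat.sig2 tagnat.rankK.
case: (tagnat.sig x) (tagnat.sig y) => i k [j l] /=.
rewrite /s -tag_eqE /tag_eq /= [j == i]eq_sym.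
case: eqP => [eq_i | _] /=; last by rewrite mxE.
case: j / eq_i in l *; rewrite tagged_asE conform_mx_id.
exact: (proj2 (sfP i)).
Qed.

Definition bdiag : monomial gT (\sum_i p i) := Monomial bdiag_subproof.

End BlockDiagonal.

End Blocks.

Section MonomialTwoGroups.

Variables (gT : finGroupType) (T R : {set gT}).

Lemma exp2S k : (2 ^ k + 2 ^ k = 2 ^ k.+1)%N.
Proof. by rewrite addnn -mul2n -expnS. Qed.

(* diag(r, 1, ..., 1); for k = 0 this is the 1 x 1 matrix (r). *)
Definition dmat k (r : gT) : monomial gT (2 ^ k) :=
  dmon (fun i : 'I_(2 ^ k) => if i == 0 :> nat then r else 1).

Fixpoint wgroup k : {set monomial gT (2 ^ k)} :=
  if k is k'.+1 then
    << [set castmon (exp2S k') (diag2 a 1) | a in wgroup k']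
       :|: [set castmon (exp2S k') (diag2 1 a) | a in wgroup k']
       :|: [set castmon (exp2S k') (diag2 (dmat k' r) (dmat k' r)^-1) | r in R]
       :|: [set castmon (exp2S k') (swap gT (2 ^ k'))] >>
  else [set dmat 0 t | t in T].

Variables (u : nat) (m : 'I_u -> nat).

Definition Wgroup : {set monomial gT (\sum_(i < u) 2 ^ m i)} :=
  [set bdiag a | a : {dffun forall i, monomial gT (2 ^ m i)}
                 in setXn (fun i => wgroup (m i))].

Definition udiag (i : 'I_u) (r : gT) : monomial gT (\sum_(i < u) 2 ^ m i) :=
  bdiag (fun j : 'I_u =>
    if (j == i) || (j == i.+1 :> nat) then dmat (m j) r else 1).

(* The indices i with i.+1 < u are the 0-based version of 1 <= i <= u - 1; for
   u = 1 there are none and Ugroup is trivial. *)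
Definition Ugroup : {set monomial gT (\sum_(i < u) 2 ^ m i)} :=
  << [set udiag i r | i in [pred i : 'I_u | i.+1 < u], r in R] >>.

Definition Sgroup := Wgroup ><| Ugroup.

End MonomialTwoGroups.

(* Main.v *)
Require Import Defs.
From HB Require Import structures.
From mathcomp Require Import all_boot all_order all_algebra all_fingroup all_solvable.
Import GroupScope.
Set Implicit Arguments.
Unset Strict Implicit.
Unset Printing Implicit Defensive.

(** A monomial matrix A is a pair: a permutation i |-> mperm A i of the rows,
    and for each row i the group element mval A i that sits in column
    mperm A i. Products become a right action together with a cocycle,
      mperm (A * B) i = mperm B (mperm A i),
      mval (A * B) i = mval A i * mval B (mperm A i),
    and nearly every computation is done in these coordinates.

    Upper bound. It holds in the group of all n x n monomial matrices over a
    finite group G, for every prime p. Let E be an elementary abelian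
    p-subgroup, and r = r_p(G). For a row i let K_i be the subgroup of those
    A in E that fix i and have entry 1 there. The stabiliser of i modulo K_i
    embeds in G through its i-th entry, so |E : K_i| <= |O| p ^ r, where O is
    the orbit of i under E. Since |O| = p ^ j and j + r <= p ^ j * r as soon as
    j = 0 or r > 0, this gives |E : K_i| <= p ^ (|O| r) ([indexK]). As E is
    abelian, an element of K_i is trivial on all of O ([K_orbit]); so the
    intersection of one K_i for each orbit is trivial, and
    |E| <= prod_O p ^ (|O| r) = p ^ (n r) ([p_rank_monover]). All the matrices
    of S(T, R, J) have their entries in TR, so the first inequality follows.

    Lower bound. The diagonal matrices with entries in an elementary abelian
    subgroup of T of maximal rank form an elementary abelian group of rank
    n r_2(T) ([leq_p_rank_dmon]). They lie in W(T, R, J), by induction on the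
    block size ([dmon_wgroup]), hence in S(T, R, J), provided that the
    semidirect product of W(T, R, J) by U(R) is a genuine one: U(R) must
    normalise W(T, R, J) and meet it trivially. For the normalisation,
    conjugation by d_k(r) permutes the generators of w_k, except that it sends
    the swap matrix to the product of the swap by a generator
    diag(d(s), d(s)^-1) ([dmat_norm_wgroup]). For the intersection, project
    TR onto its abelian factor R and multiply over all the entries of a matrix:
    this determinant ([rdet]) is a homomorphism which is trivial on w_k
    ([wgroup_rdet0]), but equal to r on d_k(r) ([rdet_dmat]). *)

(** * Coordinates on monomial matrices *)

Section MonomialCoordinates.

Variables (gT : finGroupType) (n : nat).
Implicit Types (A B : monomial gT n) (i j : 'I_n) (f g : 'I_n -> gT).

Definition mperm A i : 'I_n := odflt i [pick j | A i j != None].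
Definition mval A i : gT := odflt 1 (A i (mperm A i)).

Lemma mon_entryE A i j : A i j = if j == mperm A i then Some (mval A i) else None.
Proof.
have /monomialP[s _ [f defA]] := valP A.
suff ps : mperm A i = s i by rewrite /mval ps !defA eqxx.
rewrite /mperm; case: pickP => [k | /(_ (s i))]; rewrite /= defA ?eqxx //.
by case: (k =P s i).
Qed.

Lemma mon_entry A i j x : A i j = Some x -> mperm A i = j /\ mval A i = x.
Proof. by rewrite mon_entryE; case: eqP => // -> [->]. Qed.

Lemma mon_eq A B : mperm A =1 mperm B -> mval A =1 mval B -> A = B.
Proof.
move=> eq_p eq_v; apply/val_inj/matrixP=> i j /=.
by rewrite !mon_entryE eq_p eq_v.
Qed.

Lemma mon_entryM A B i :
  mperm (A * B) i = mperm B (mperm A i) /\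
  mval (A * B) i = mval A i * mval B (mperm A i).
Proof.
apply: mon_entry; rewrite (mulmonP (mon_entryE A) (mon_entryE B)).
by rewrite eqxx.
Qed.

Lemma mpermM A B i : mperm (A * B) i = mperm B (mperm A i).
Proof. by case: (mon_entryM A B i). Qed.

Lemma mvalM A B i : mval (A * B) i = mval A i * mval B (mperm A i).
Proof. by case: (mon_entryM A B i). Qed.

Lemma mon_entry_dmon f i : mperm (dmon f) i = i /\ mval (dmon f) i = f i.
Proof. by apply: mon_entry; rewrite mxE eqxx. Qed.

Lemma mperm_dmon f i : mperm (dmon f) i = i.
Proof. by case: (mon_entry_dmon f i). Qed.

Lemma mval_dmon f i : mval (dmon f) i = f i.
Proof. by case: (mon_entry_dmon f i). Qed.

Lemma mperm1 i : mperm 1 i = i. Proof. exact: mperm_dmon. Qed.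
Lemma mval1 i : mval 1 i = 1. Proof. exact: mval_dmon. Qed.

Lemma dmonM f g : dmon f * dmon g = dmon (fun i => f i * g i).
Proof. by apply: mon_eq => i; rewrite ?mpermM ?mvalM !mperm_dmon ?mval_dmon. Qed.

Lemma eq_dmon f g : f =1 g -> dmon f = dmon g.
Proof. by move=> eq_fg; apply: mon_eq => i; rewrite ?mperm_dmon ?mval_dmon. Qed.

Lemma mperm_is_action : is_action [set: monomial gT n] (fun i A => mperm A i).
Proof.
apply: is_total_action => [i | i A B]; first exact: mperm1.
by rewrite mpermM.
Qed.
Canonical mperm_action := Action mperm_is_action.

Lemma mperm_inj A : injective (mperm A).
Proof. exact: (act_inj mperm_action A). Qed.

(** The cocycle becomes a homomorphism on the stabiliser of a row. *)
Lemma mval_morphM i :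
  {in 'C[i | mperm_action] &, {morph (mval^~ i) : A B / A * B}}.
Proof. by move=> A B /astab1P/= fixA _; rewrite mvalM fixA. Qed.

Canonical mval_morphism i := Morphism (@mval_morphM i).

Variable H : {group gT}.

Definition monover := [set A : monomial gT n | [forall i, mval A i \in H]].

Lemma monoverP A : reflect (forall i, mval A i \in H) (A \in monover).
Proof. by rewrite inE; apply: forallP. Qed.

Lemma monover_group_set : group_set monover.
Proof.
apply/group_setP; split=> [|A B /monoverP HA /monoverP HB].
  by apply/monoverP=> i; rewrite mval1 group1.
by apply/monoverP=> i; rewrite mvalM groupM.
Qed.
Canonical monover_group := Group monover_group_set.

End MonomialCoordinates.

Arguments mperm_action {gT n}.
Arguments mval_morphism {gT n} i.

(** * The rank of a group of monomial matrices *)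

Lemma indexgI_leq (gT : finGroupType) (E A B : {group gT}) :
  (#|E : A :&: B| <= #|E : A| * #|E : B|)%N.
Proof.
rewrite -(indexgI E (A :&: B)) -(@Lagrange_index _ E (E :&: A) (E :&: (A :&: B)))
  ?subsetIl //=; last first.
  by rewrite setIA subsetIl.
rewrite /= indexgI leq_mul // setIA (indexgI (E :&: A) B).
exact/subset_leq_card/imsetS/subsetIl.
Qed.

Lemma index_bigcap_leq (gT : finGroupType) (I : finType) (P : pred I)
    (E : {group gT}) (K : I -> {group gT}) :
  (#|E : \bigcap_(i | P i) K i| <= \prod_(i | P i) #|E : K i|)%N.
Proof.
elim: (index_enum I) => [|i r IHr].
  by rewrite !big_nil -(indexgI E [group of setT]) setIT indexgg.
rewrite !big_cons; case: (P i) => //.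
have [G defG]: exists G : {group gT}, \bigcap_(i <- r | P i) K i = G.
  elim/big_ind: _ => [|_ _ [A ->] [B ->] | j _]; first by exists [group of setT].
    by exists [group of A :&: B].
  by exists (K j).
rewrite defG in IHr *.
exact: leq_trans (indexgI_leq _ _ _) (leq_mul (leqnn _) IHr).
Qed.

Section RankBound.

Variables (gT : finGroupType) (n p : nat) (G : {group gT}).
Variable E : {group monomial gT n}.
Hypotheses (p_pr : prime p) (abelE : p.-abelem E) (sEG : E \subset monover n G).
Hypothesis pG : (1 < n -> p %| #|G|)%N.

Let to := @mperm_action gT n.
Let r := 'r_p(G).
Let K i := 'ker_E (mval_morphism i).

Let memK i A : (A \in K i) = [&& A \in E, mperm A i == i & mval A i == 1].
Proof. by rewrite !inE; congr (_ && _); rewrite /= sub1set inE. Qed.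

(** If B in E moves i to j and A in K_i commutes with B, then comparing the i-th
    rows of A * B and B * A shows that A fixes j, with entry 1 there. *)
Let K_orbit i j : j \in orbit to E i -> K i \subset K j.
Proof.
case/orbitP=> B EB <-; apply/subsetP=> A; rewrite !memK /= => /and3P[EA /eqP pA /eqP vA].
have /centsP/(_ A EA B EB) cAB := abelem_abelian abelE.
have pAB : mperm A (mperm B i) = mperm B i by rewrite -mpermM -cAB mpermM pA.
rewrite EA pAB eqxx; apply/eqP/(mulgI (mval B i)).
by rewrite mulg1 -mvalM -cAB mvalM vA pA mul1g.
Qed.

(** The index is the orbit length p ^ j times the order of an elementary abelian
    subgroup of G, and j + r <= p ^ j * r, except when r = 0 < j. *)
Let indexK i : (#|E : K i| <= p ^ (#|orbit to E i| * r))%N.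
Proof.
have pE := abelem_pgroup abelE.
have abelF : p.-abelem (mval_morphism i @* E) by apply: morphim_abelem.
have -> : #|E : K i| = (#|orbit to E i| * #|mval_morphism i @* E|)%N.
  rewrite card_orbit card_morphim (setIC 'C[i | to]) -[#|_ : 'ker _|]indexgI -setIA.
  have sKC: 'ker (mval_morphism i) \subset 'C[i | to] by apply: subsetIl.
  rewrite (setIidPr sKC).
  by rewrite Lagrange_index ?subsetIl // setIS ?subsetIl.
have [j defO] : {j | #|orbit to E i| = (p ^ j)%N}.
  by apply: p_natP; rewrite card_orbit; apply: pnat_dvd (dvdn_indexg _ _) pE.
rewrite defO (card_pgroup (abelem_pgroup abelF)) -expnD leq_exp2l ?prime_gt1 //.
have le_r : (logn p #|mval_morphism i @* E| <= r)%N.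
  apply: logn_le_p_rank; rewrite inE abelF andbT.
  apply/subsetP=> _ /morphimP[A _ EA ->] /=.
  by have /monoverP := subsetP sEG A EA.
(* A nontrivial orbit forces n > 1, so that p divides #|G|. *)
have [-> | j_gt0] := posnP j; first by rewrite expn0 mul1n.
have r_gt0 : (0 < r)%N.
  rewrite p_rank_gt0 mem_primes p_pr cardG_gt0 pG //.
  rewrite -[n]card_ord -cardsT; apply: leq_trans (subset_leq_card (subsetT (orbit to E i))).
  by rewrite defO -(expn0 p) ltn_exp2l ?prime_gt1.
apply: leq_trans (leq_add (leq_pmulr j r_gt0) le_r) _.
by rewrite addnC -mulSn leq_mul // ltn_expl ?prime_gt1.
Qed.

Lemma card_abelem_monover : (#|E| <= p ^ (n * r))%N.
Proof.
pose P := [set orbit to E i | i in [set: 'I_n]].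
have trivK : E :&: \bigcap_(O in P) \bigcap_(i in O) K i = 1.
  apply/trivgP/subsetP=> A /setIP[EA /bigcapP KA]; apply/set1P/mon_eq=> i.
    have /bigcapP/(_ i (orbit_refl _ _ _)) := KA _ (imset_f _ (in_setT i)).
    by rewrite memK mperm1 => /and3P[_ /eqP].
  have /bigcapP/(_ i (orbit_refl _ _ _)) := KA _ (imset_f _ (in_setT i)).
  by rewrite memK mval1 => /and3P[_ _ /eqP].
(* The intersection over each orbit is its common K i, which avoids choosing
   representatives. *)
have indexE := indexgI E [group of \bigcap_(O in P) [group of \bigcap_(i in O) K i]].
rewrite /= trivK indexg1 in indexE; rewrite indexE.
apply: leq_trans (@index_bigcap_leq _ _ (mem P) E
  (fun O => [group of \bigcap_(i in O) K i])) _ => /=.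
have ->: (n * r = \sum_(O in P) #|O| * r)%N.
  rewrite -big_distrl /= -(@card_partition _ P setT) ?cardsT ?card_ord //.
  apply/orbit_partition/subsetP=> A _.
  by rewrite !inE; apply/subsetP=> i _; rewrite !inE.
rewrite expn_sum; apply: leq_prod => _ /imsetP[i _ ->].
apply: leq_trans (indexK i); apply: dvdn_leq => //; apply: indexgS.
by apply/bigcapsP=> j Oj; apply: K_orbit.
Qed.

End RankBound.

(** The hypothesis excludes permutation matrices over a group of order prime
    to p: there r_p(G) = 0, but the p-rank of the symmetric group can be
    positive. *)
Lemma p_rank_monover (gT : finGroupType) (n p : nat) (G : {group gT}) :
  prime p -> (1 < n -> p %| #|G|)%N -> ('r_p(monover n G) <= n * 'r_p(G))%N.
Proof.
move=> p_pr pG; have [E /pnElemP[sEG abelE <-]] :=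
  p_rank_witness p (monover_group n G).
rewrite -(leq_exp2l _ _ (prime_gt1 p_pr)) -card_pgroup ?(abelem_pgroup abelE) //.
exact: card_abelem_monover.
Qed.

(** The diagonal matrices with entries in E form a group isomorphic to E ^ n. *)
Lemma leq_p_rank_dmon (gT : finGroupType) (n p : nat) (H : {group gT})
    (S : {set monomial gT n}) :
  prime p -> (forall f, (forall i, f i \in H) -> dmon f \in S) ->
  (n * 'r_p(H) <= 'r_p(S))%N.
Proof.
move=> p_pr sHS; have [E /pnElemP[sEH abelE <-]] := p_rank_witness p H.
have [_ abE expE] := and3P abelE.
pose D := [set dmon f | f : {ffun 'I_n -> gT} in ffun_on E].
have DP A :
    reflect (exists2 f : 'I_n -> gT, forall i, f i \in E & A = dmon f) (A \in D).
  apply: (iffP imsetP) => [[f /ffun_onP Ef ->] | [f Ef ->]]; first by exists f.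
  exists [ffun i => f i]; first by apply/ffun_onP=> i; rewrite ffunE.
  by apply: eq_dmon => i; rewrite ffunE.
have gD : group_set D.
  apply/group_setP; split=> [|_ _ /DP[f Ef ->] /DP[g Eg ->]].
    by apply/DP; exists (fun=> 1).
  by apply/DP; exists (fun i => f i * g i) => [i|]; rewrite ?groupM ?dmonM.
have cardD : #|D| = (#|E| ^ n)%N.
  rewrite card_imset ?card_ffun_on ?card_ord // => f g eq_fg.
  apply/ffunP=> i; have := congr1 (fun A : monomial gT n => mval A i) eq_fg.
  by rewrite /= !mval_dmon.
have abelD : p.-abelem (Group gD).
  rewrite abelemE //; apply/andP; split.
    apply/centsP=> _ /DP[f Ef ->] _ /DP[g Eg ->]; rewrite /commute !dmonM.
    by apply: eq_dmon => i; apply: (centsP abE).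
  apply/exponentP=> _ /DP[f Ef ->].
  have X k : dmon f ^+ k = dmon (fun i => f i ^+ k).
    elim: k => [|k IHk]; first by apply: eq_dmon.
    by rewrite expgS IHk dmonM; apply: eq_dmon => i; rewrite expgS.
  by rewrite X; apply: eq_dmon => i; apply: (exponentP expE).
apply: leq_trans (logn_le_p_rank (E := Group gD) _).
  by rewrite /= cardD lognX.
rewrite inE abelD andbT; apply/subsetP=> _ /DP[f Ef ->].
by apply: sHS => i; apply: (subsetP sEH).
Qed.


(** * Block matrices *)

Section Blocks.

Variable gT : finGroupType.

Lemma castmon_id n (e : n = n) (A : monomial gT n) : castmon e A = A.
Proof. by apply: val_inj; rewrite /= castmx_id. Qed.

Lemma castmonM n1 n2 (e : n1 = n2) : {morph @castmon gT n1 n2 e : A B / A * B}.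
Proof. by case: n2 / e => A B; rewrite !castmon_id. Qed.

Lemma castmonV n1 n2 (e : n1 = n2) : {morph @castmon gT n1 n2 e : A / A^-1}.
Proof. by case: n2 / e => A; rewrite !castmon_id. Qed.

Lemma castmon_dmon n1 n2 (e : n1 = n2) (f : 'I_n2 -> gT) :
  castmon e (dmon (fun i => f (cast_ord e i))) = dmon f.
Proof.
case: n2 / e in f *; rewrite castmon_id; apply: eq_dmon => i.
by rewrite cast_ord_id.
Qed.

Lemma mon_entry_diag2 n1 n2 (A : monomial gT n1) (B : monomial gT n2) :
  (forall i, mperm (diag2 A B) (lshift n2 i) = lshift n2 (mperm A i) /\
             mval (diag2 A B) (lshift n2 i) = mval A i) /\
  (forall i, mperm (diag2 A B) (rshift n1 i) = rshift n1 (mperm B i) /\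
             mval (diag2 A B) (rshift n1 i) = mval B i).
Proof.
by split=> i; apply: mon_entry;
  rewrite /= /block_mx ?col_mxEu ?col_mxEd ?row_mxEl ?row_mxEr mon_entryE eqxx.
Qed.

Lemma mperm_diag2 n1 n2 (A : monomial gT n1) (B : monomial gT n2) :
  (forall i, mperm (diag2 A B) (lshift n2 i) = lshift n2 (mperm A i)) *
  (forall i, mperm (diag2 A B) (rshift n1 i) = rshift n1 (mperm B i)).
Proof. by have [l r] := mon_entry_diag2 A B; split=> i; [case: (l i) | case: (r i)]. Qed.

Lemma mval_diag2 n1 n2 (A : monomial gT n1) (B : monomial gT n2) :
  (forall i, mval (diag2 A B) (lshift n2 i) = mval A i) *
  (forall i, mval (diag2 A B) (rshift n1 i) = mval B i).
Proof. by have [l r] := mon_entry_diag2 A B; split=> i; [case: (l i) | case: (r i)]. Qed.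

Lemma mon_eq2 n1 n2 (A B : monomial gT (n1 + n2)) :
  (forall i, mperm A (lshift n2 i) = mperm B (lshift n2 i) /\
             mval A (lshift n2 i) = mval B (lshift n2 i)) ->
  (forall i, mperm A (rshift n1 i) = mperm B (rshift n1 i) /\
             mval A (rshift n1 i) = mval B (rshift n1 i)) ->
  A = B.
Proof.
move=> eql eqr; apply: mon_eq => i;
  by case: (split_ordP i) => j ->; [case: (eql j) | case: (eqr j)].
Qed.

Lemma diag2M n1 n2 (A A' : monomial gT n1) (B B' : monomial gT n2) :
  diag2 A B * diag2 A' B' = diag2 (A * A') (B * B').
Proof.
by apply: mon_eq2 => i; rewrite ?(mpermM, mvalM) !mperm_diag2 ?mval_diag2
  ?(mpermM, mvalM).
Qed.

Lemma diag2_1 n1 n2 : diag2 1 1 = 1 :> monomial gT (n1 + n2).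
Proof. by apply: (mulgI (diag2 1 1)); rewrite diag2M !mulg1. Qed.

Lemma diag2V n1 n2 (A : monomial gT n1) (B : monomial gT n2) :
  (diag2 A B)^-1 = diag2 A^-1 B^-1.
Proof. by apply: (mulIg (diag2 A B)); rewrite diag2M !mulVg diag2_1. Qed.

Lemma diag2J n1 n2 (A A' : monomial gT n1) (B B' : monomial gT n2) :
  diag2 A B ^ diag2 A' B' = diag2 (A ^ A') (B ^ B').
Proof. by rewrite !conjgE diag2V !diag2M. Qed.

Lemma diag2_dmon n1 n2 (f : 'I_(n1 + n2) -> gT) :
  diag2 (dmon (fun i => f (lshift n2 i))) (dmon (fun i => f (rshift n1 i))) = dmon f.
Proof.
by apply: mon_eq2 => i; rewrite mperm_diag2 mval_diag2 !mperm_dmon !mval_dmon.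
Qed.

Lemma mon_entry_swap n :
  (forall i, mperm (swap gT n) (lshift n i) = rshift n i /\
             mval (swap gT n) (lshift n i) = 1) /\
  (forall i, mperm (swap gT n) (rshift n i) = lshift n i /\
             mval (swap gT n) (rshift n i) = 1).
Proof.
by split=> i; apply: mon_entry;
  rewrite /= /block_mx ?col_mxEu ?col_mxEd ?row_mxEl ?row_mxEr mxE eqxx.
Qed.

Lemma mperm_swap n :
  (forall i, mperm (swap gT n) (lshift n i) = rshift n i) *
  (forall i, mperm (swap gT n) (rshift n i) = lshift n i).
Proof. by have [l r] := mon_entry_swap n; split=> i; [case: (l i) | case: (r i)]. Qed.

Lemma mval_swap n i : mval (swap gT n) i = 1.
Proof.
have [l r] := mon_entry_swap n.
by case: (split_ordP i) => j ->; [case: (l j) | case: (r j)].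
Qed.

Lemma diag2_swap n (A B : monomial gT n) :
  diag2 A B * swap gT n = swap gT n * diag2 B A.
Proof.
by apply: mon_eq2 => i;
  rewrite !mpermM !mvalM !(mperm_diag2, mperm_swap) !mval_diag2 !mval_swap
    !(mul1g, mulg1).
Qed.

Section BlockDiagonal.

Variables (u : nat) (p : 'I_u -> nat).
Implicit Types a b : forall i, monomial gT (p i).

Lemma Rank_sig (x : 'I_(\sum_i p i)) : {i & {k : 'I_(p i) | x = tagnat.Rank i k}}.
Proof.
by exists (tagnat.sig1 x), (tagnat.sig2 x); rewrite tagnat.sig2K.
Qed.

Lemma mon_entry_bdiag a i k :
  mperm (bdiag a) (tagnat.Rank i k) = tagnat.Rank i (mperm (a i) k) /\
  mval (bdiag a) (tagnat.Rank i k) = mval (a i) k.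
Proof.
apply: mon_entry; rewrite mxE /tagnat.sig1 /tagnat.sig2 !tagnat.rankK /= eqxx.
by rewrite conform_mx_id mon_entryE eqxx.
Qed.

Lemma mperm_bdiag a i k :
  mperm (bdiag a) (tagnat.Rank i k) = tagnat.Rank i (mperm (a i) k).
Proof. by case: (mon_entry_bdiag a k). Qed.

Lemma mval_bdiag a i k : mval (bdiag a) (tagnat.Rank i k) = mval (a i) k.
Proof. by case: (mon_entry_bdiag a k). Qed.

Lemma eq_bdiag a b : (forall i, a i = b i) -> bdiag a = bdiag b.
Proof.
by move=> eq_ab; apply: mon_eq => x; have [i [k ->]] := Rank_sig x;
  rewrite ?(mperm_bdiag, mval_bdiag) eq_ab.
Qed.

Lemma bdiag_inj a b : bdiag a = bdiag b -> forall i, a i = b i.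
Proof.
move=> eq_ab i; apply: mon_eq => k.
  have Rank_inj : injective (@tagnat.Rank _ p i).
    move=> j j' eqR; apply/val_inj/eqP; have := tagnat.eq_Rank j j'.
    by rewrite eqR !eqxx => /esym.
  by apply: Rank_inj; rewrite -!mperm_bdiag eq_ab.
by rewrite -!mval_bdiag eq_ab.
Qed.

Lemma bdiagM a b : bdiag a * bdiag b = bdiag (fun i => a i * b i).
Proof.
by apply: mon_eq => x; have [i [k ->]] := Rank_sig x;
  rewrite !(mpermM, mvalM, mperm_bdiag, mval_bdiag).
Qed.

Lemma bdiag1 : bdiag (fun i => 1 : monomial gT (p i)) = 1.
Proof.
apply: (mulgI (bdiag (fun i => 1 : monomial gT (p i)))).
by rewrite bdiagM mulg1; apply: eq_bdiag => i; rewrite mulg1.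
Qed.

Lemma bdiagV a : (bdiag a)^-1 = bdiag (fun i => (a i)^-1).
Proof.
apply: (mulIg (bdiag a)); rewrite bdiagM mulVg -bdiag1.
by apply: eq_bdiag => i; rewrite mulVg.
Qed.

Lemma bdiagJ a b : bdiag a ^ bdiag b = bdiag (fun i => a i ^ b i).
Proof. by rewrite conjgE bdiagV !bdiagM; apply: eq_bdiag => i; rewrite conjgE. Qed.

Lemma bdiag_dmon (f : 'I_(\sum_i p i) -> gT) :
  bdiag (fun i => dmon (fun k => f (tagnat.Rank i k))) = dmon f.
Proof.
by apply: mon_eq => x; have [i [k ->]] := Rank_sig x;
  rewrite ?(mperm_bdiag, mval_bdiag) !(mperm_dmon, mval_dmon).
Qed.

End BlockDiagonal.

End Blocks.

(** * The groups w_k(T, R, J) *)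

Section MonomialTwoGroups.

Import FiniteModule.

Variables (gT : finGroupType) (T R TR : {group gT}).
Hypotheses (defTR : T ><| R = TR) (abelR : abelian R).
Implicit Types (k : nat) (r s t x : gT).

Lemma mem_wgroup_diag2l k a :
  a \in wgroup T R k -> castmon (exp2S k) (diag2 a 1) \in wgroup T R k.+1.
Proof. by move=> wa; apply/mem_gen; do 3!(apply/setUP; left); apply/imsetP; exists a. Qed.

Lemma mem_wgroup_diag2r k a :
  a \in wgroup T R k -> castmon (exp2S k) (diag2 1 a) \in wgroup T R k.+1.
Proof.
move=> wa; apply/mem_gen; do 2!(apply/setUP; left).
by apply/setUP; right; apply/imsetP; exists a.
Qed.

Lemma mem_wgroup_dmatV k r : r \in R ->
  castmon (exp2S k) (diag2 (dmat k r) (dmat k r)^-1) \in wgroup T R k.+1.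
Proof.
by move=> Rr; apply/mem_gen/setUP; left; apply/setUP; right; apply/imsetP; exists r.
Qed.

Lemma mem_wgroup_swap k : castmon (exp2S k) (swap gT (2 ^ k)) \in wgroup T R k.+1.
Proof. by apply/mem_gen/setUP; right; apply/set1P. Qed.

Lemma wgroupS_sub k (L : {group monomial gT (2 ^ k.+1)}) :
    {in wgroup T R k, forall a, castmon (exp2S k) (diag2 a 1) \in L} ->
    {in wgroup T R k, forall a, castmon (exp2S k) (diag2 1 a) \in L} ->
    {in R, forall r, castmon (exp2S k) (diag2 (dmat k r) (dmat k r)^-1) \in L} ->
    castmon (exp2S k) (swap gT (2 ^ k)) \in L ->
  wgroup T R k.+1 \subset L.
Proof.
move=> Ll Lr Ld Ls; rewrite gen_subG !subUset sub1set Ls andbT.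
by rewrite -andbA; apply/and3P; split; apply/subsetP=> _ /imsetP[a ? ->];
  [apply: Ll | apply: Lr | apply: Ld].
Qed.

Lemma dmatM k r s : dmat k r * dmat k s = dmat k (r * s).
Proof. by rewrite dmonM; apply: eq_dmon => i; case: ifP; rewrite ?mulg1. Qed.

Lemma dmat1 k : dmat k 1 = 1 :> monomial gT _.
Proof. by apply: eq_dmon => i; rewrite if_same. Qed.

Lemma dmatV k r : (dmat k r)^-1 = dmat k r^-1.
Proof. by apply: (mulIg (dmat k r)); rewrite dmatM !mulVg dmat1. Qed.

Lemma mval_dmat k r (i : 'I_(2 ^ k)) : mval (dmat k r) i = if i == 0 :> nat then r else 1.
Proof. exact: mval_dmon. Qed.

Lemma dmatJ k r s : dmat k r ^ dmat k s = dmat k (r ^ s).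
Proof. by rewrite !conjgE dmatV !dmatM. Qed.

Lemma dmatS k r : dmat k.+1 r = castmon (exp2S k) (diag2 (dmat k r) 1).
Proof.
rewrite /dmat -(castmon_dmon (exp2S k)); congr (castmon _ _).
rewrite -diag2_dmon; congr (diag2 _ _); apply: eq_dmon => i //=.
by rewrite addn_eq0 expn_eq0.
Qed.

Lemma wgroup_group_set k : group_set (wgroup T R k).
Proof.
case: k => [|k]; last exact: groupP.
apply/group_setP; split=> [|_ _ /imsetP[t Tt ->] /imsetP[s Ts ->]].
  by rewrite -(dmat1 0) imset_f.
by rewrite dmatM imset_f ?groupM.
Qed.
Canonical wgroup_group k := Group (wgroup_group_set k).

Let nTR : R \subset 'N(T). Proof. by case/sdprod_context: defTR. Qed.
Let sTTR : T \subset TR. Proof. by case/sdprod_context: defTR => /andP[]. Qed.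
Let sRTR : R \subset TR. Proof. by case/sdprod_context: defTR. Qed.

(** The step from k to k + 1 uses d_(k+1)(r) = diag(d, 1) with d = d_k(r). The
    only generator that conjugation moves out of its own family is the swap
    matrix P, for which P ^ diag(d, 1) = diag(d^-1, d) * P. *)
Lemma dmat_norm_wgroup k r : r \in R -> dmat k r \in 'N(wgroup T R k).
Proof.
move=> Rr; elim: k => [|k IHk].
  rewrite inE; apply/subsetP=> _ /imsetP[_ /imsetP[t Tt ->] ->].
  by rewrite dmatJ imset_f // memJ_norm // (subsetP nTR).
rewrite inE sub_conjg; apply: wgroupS_sub => [a wa | a wa | s Rs |];
  rewrite mem_conjgV dmatS conjgE -castmonV -!castmonM -conjgE ?diag2J ?conjg1 ?conj1g.
- by rewrite mem_wgroup_diag2l ?memJ_norm.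
- exact: mem_wgroup_diag2r.
- by rewrite dmatJ conjgE (centsP abelR _ Rs _ Rr) mulKg mem_wgroup_dmatV.
rewrite conjgE -diag2_swap mulgA !diag2V diag2M !(mul1g, mulg1, invg1) castmonM.
rewrite groupM ?mem_wgroup_swap // -{2}[dmat k r]invgK dmatV.
by rewrite mem_wgroup_dmatV ?groupV.
Qed.

(** diag(D1, D2) = diag(D1, 1) * diag(1, D2) is a product of generators. *)
Lemma dmon_wgroup k f : (forall i, f i \in T) -> dmon f \in wgroup T R k.
Proof.
elim: k f => [|k IHk] f Tf.
  apply/imsetP; exists (f ord0) => //; apply: eq_dmon => i.
  by rewrite (ord1 i).
rewrite -(castmon_dmon (exp2S k)) -diag2_dmon.
rewrite -[X in diag2 X _]mulg1 -[X in diag2 _ X]mul1g -diag2M castmonM groupM //.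
  by rewrite mem_wgroup_diag2l ?IHk.
by rewrite mem_wgroup_diag2r ?IHk.
Qed.

Section Rdet.

(** The projection of TR onto R, followed by the passage to additive notation,
    which makes sums over the rows of a matrix available. *)
Definition rproj x : fmod_of abelR := fmod abelR (remgr T R x).

Lemma rprojM : {in TR &, {morph rproj : x y / x * y >-> (x + y)%R}}.
Proof.
have [nsTTR _ defTR' _ _] := sdprod_context defTR => x y TRx TRy.
rewrite /rproj (remgrM (sdprod_compl defTR) nsTTR) // fmodM //;
  by rewrite mem_remgr ?defTR'.
Qed.

Lemma rproj_id r : r \in R -> rproj r = fmod abelR r.
Proof. by move=> Rr; rewrite /rproj remgr_id //; case/sdprod_context: defTR. Qed.

Lemma rprojT t : t \in T -> rproj t = 0%R.
Proof. by move=> Tt; rewrite /rproj remgr1 // fmod1. Qed.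

Variable n : nat.
Implicit Types A B : monomial gT n.

(** The determinant of the image of A over the abelian group R, up to the sign. *)
Definition rdet A : fmod_of abelR := (\sum_i rproj (mval A i))%R.

Lemma rdetM : {in monover n TR &, {morph rdet : A B / A * B >-> (A + B)%R}}.
Proof.
move=> A B /monoverP TRA /monoverP TRB; rewrite /rdet.
rewrite [X in (_ + X)%R](reindex_inj (@mperm_inj _ _ A)) -big_split /=.
by apply: eq_bigr => i _; rewrite mvalM rprojM.
Qed.

Definition rdet0 := [set A in monover n TR | rdet A == 0%R].

Lemma in_rdet0 A : (A \in rdet0) = (A \in monover n TR) && (rdet A == 0%R).
Proof. by rewrite inE. Qed.

Lemma rdet1 : rdet 1 = 0%R.
Proof. by rewrite /rdet big1 // => i _; rewrite mval1; apply: rprojT. Qed.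

Lemma rdet0_group_set : group_set rdet0.
Proof.
apply/group_setP; split=> [|A B /setIdP[TRA /eqP A0] /setIdP[TRB /eqP B0]].
  by rewrite in_rdet0 group1 rdet1 eqxx.
by rewrite in_rdet0 groupM // rdetM // A0 B0 GRing.addr0 eqxx.
Qed.
Canonical rdet0_group := Group rdet0_group_set.

End Rdet.

Lemma dmat_monover k r : r \in R -> dmat k r \in monover (2 ^ k) TR.
Proof.
move=> Rr; apply/monoverP=> i; rewrite mval_dmat.
by case: ifP => // _; apply: (subsetP sRTR).
Qed.

Lemma rdet_castmon n1 n2 (e : n1 = n2) (A : monomial gT n1) :
  rdet (castmon e A) = rdet A.
Proof. by case: n2 / e; rewrite castmon_id. Qed.

Lemma castmon_monover n1 n2 (e : n1 = n2) (A : monomial gT n1) :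
  (castmon e A \in monover n2 TR) = (A \in monover n1 TR).
Proof. by case: n2 / e; rewrite castmon_id. Qed.

Lemma rdet_diag2 n1 n2 (A : monomial gT n1) (B : monomial gT n2) :
  rdet (diag2 A B) = (rdet A + rdet B)%R.
Proof.
rewrite /rdet big_split_ord /=.
by congr (_ + _)%R; apply: eq_bigr => i _; rewrite mval_diag2.
Qed.

Lemma diag2_monover n1 n2 (A : monomial gT n1) (B : monomial gT n2) :
  A \in monover n1 TR -> B \in monover n2 TR -> diag2 A B \in monover (n1 + n2) TR.
Proof.
move=> /monoverP TRA /monoverP TRB; apply/monoverP=> i.
by case: (split_ordP i) => j ->; rewrite mval_diag2.
Qed.

Lemma rdet_dmat k r : r \in R -> rdet (dmat k r) = fmod abelR r.
Proof.
move=> Rr; have i0 : 'I_(2 ^ k) by exists 0%N; rewrite expn_gt0.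
pose i1 : 'I_(2 ^ k) := Ordinal (leq_ltn_trans (leq0n i0) (ltn_ord i0)).
rewrite /rdet (bigD1 i1) //= big1 => [|i /negPf].
  by rewrite GRing.addr0 mval_dmat rproj_id.
by rewrite -val_eqE /= => ne_i; rewrite mval_dmat ne_i rprojT.
Qed.

(** w_0 is over T, and the generators that are new at each later level are a
    permutation matrix and the diag(d, d^-1). *)
Lemma wgroup_rdet0 k : wgroup T R k \subset rdet0 (2 ^ k).
Proof.
elim: k => [|k /subsetP IHk].
  apply/subsetP=> _ /imsetP[t Tt ->].
  have Tt0 i : mval (dmat 0 t) i \in T by rewrite mval_dmat; case: ifP.
  rewrite in_rdet0 /rdet big1 ?eqxx ?andbT => [|i _]; last exact: rprojT.
  by apply/monoverP=> i; apply: (subsetP sTTR).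
apply: wgroupS_sub =>
    [a /IHk/setIdP[TRa /eqP a0] | a /IHk/setIdP[TRa /eqP a0] | r Rr |];
  rewrite in_rdet0 castmon_monover rdet_castmon.
- by rewrite diag2_monover ?group1 // rdet_diag2 a0 rdet1 GRing.addr0 /=.
- by rewrite diag2_monover ?group1 // rdet_diag2 a0 rdet1 GRing.addr0 /=.
(* The two blocks contribute rdet d + rdet d^-1 = rdet 1. *)
- have TRr := dmat_monover k Rr.
  by rewrite diag2_monover ?groupV // rdet_diag2 -rdetM ?groupV // mulgV rdet1 /=.
apply/andP; split; last by rewrite /rdet big1 // => i _; rewrite mval_swap rprojT.
by apply/monoverP=> i; rewrite mval_swap.
Qed.

(** * The semidirect product S(T, R, J) *)

Variables (u : nat) (m : 'I_u -> nat).

Lemma WgroupP A :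
  reflect (exists2 a : forall i, monomial gT (2 ^ m i),
             (forall i, a i \in wgroup T R (m i)) & A = bdiag a)
          (A \in Wgroup T R m).
Proof.
apply: (iffP imsetP) => [[a wa ->] | [a wa ->]].
  by exists a => //; move: wa; rewrite in_setXn => /forallP.
exists (finfun a).
  by rewrite in_setXn; apply/forallP=> i; rewrite ffunE; apply: wa.
by apply: eq_bdiag => i; rewrite ffunE.
Qed.

Lemma Wgroup_group_set : group_set (Wgroup T R m).
Proof.
apply/group_setP; split=> [|_ _ /WgroupP[a wa ->] /WgroupP[b wb ->]].
  by apply/WgroupP; exists (fun=> 1) => [i|]; rewrite ?group1 ?bdiag1.
apply/WgroupP; exists (fun i => a i * b i) => [i|]; last by rewrite bdiagM.
by apply: groupM; [apply: wa | apply: wb].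
Qed.
Canonical Wgroup_group := Group Wgroup_group_set.

(** All the diag(d_(m_1)(r_1), ..., d_(m_u)(r_u)): a group that contains U(R) and
    whose elements are visible, whereas U(R) is only known by generators. *)
Definition bdmat : {set monomial gT (\sum_(i < u) 2 ^ m i)} :=
  [set bdiag (fun i => dmat (m i) (r i)) | r : {ffun 'I_u -> gT} in ffun_on R].

Lemma bdmatP A :
  reflect (exists2 r : 'I_u -> gT, forall i, r i \in R & A = bdiag (fun i => dmat (m i) (r i)))
          (A \in bdmat).
Proof.
apply: (iffP imsetP) => [[r /ffun_onP Rr ->] | [r Rr ->]]; first by exists r.
exists [ffun i => r i]; first by apply/ffun_onP=> i; rewrite ffunE.
by apply: eq_bdiag => i; rewrite ffunE.
Qed.

Lemma bdmat_group_set : group_set bdmat.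
Proof.
apply/group_setP; split=> [|_ _ /bdmatP[r Rr ->] /bdmatP[s Rs ->]].
  apply/bdmatP; exists (fun=> 1) => //.
  by rewrite -bdiag1; apply: eq_bdiag => i; rewrite dmat1.
apply/bdmatP; exists (fun i => r i * s i) => [i|]; first by rewrite groupM.
by rewrite bdiagM; apply: eq_bdiag => i; rewrite dmatM.
Qed.
Canonical bdmat_group := Group bdmat_group_set.

Lemma Ugroup_bdmat : Ugroup R m \subset bdmat.
Proof.
rewrite gen_subG; apply/subsetP=> _ /imset2P[i r _ Rr ->].
apply/bdmatP; exists (fun j : 'I_u => if (j == i) || (j == i.+1 :> nat) then r else 1).
  by move=> j; case: ifP.
by apply: eq_bdiag => j; case: ifP; rewrite ?dmat1.
Qed.

Lemma bdmat_norm_Wgroup : bdmat \subset 'N(Wgroup T R m).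
Proof.
apply/subsetP=> _ /bdmatP[r Rr ->]; rewrite inE.
apply/subsetP=> _ /imsetP[_ /WgroupP[a wa ->] ->]; rewrite bdiagJ.
apply/WgroupP; exists (fun i => a i ^ dmat (m i) (r i)) => // i.
by rewrite memJ_norm ?dmat_norm_wgroup //; apply: wa.
Qed.

(** Each block of an element of W(T, R, J) has trivial determinant over R, and
    the determinant of d_k(r) is r. *)
Lemma Wgroup_bdmat_TI : Wgroup T R m :&: bdmat = 1.
Proof.
apply/trivgP/subsetP=> _ /setIP[/WgroupP[a wa ->] /bdmatP[r Rr eq_ar]].
rewrite eq_ar inE -bdiag1; apply/eqP/eq_bdiag => i.
have /setIdP[_ /eqP] := subsetP (wgroup_rdet0 _) _ (wa i).
rewrite (bdiag_inj eq_ar) rdet_dmat // => ri0.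
suff ->: r i = 1 by rewrite dmat1.
by apply: (injmP (injm_fmod abelR)); rewrite ?group1 //= ri0 fmod1.
Qed.

(** The product [><|] has the default value set0, so that this equality contains
    the fact that it is a genuine semidirect product. *)
Lemma Sgroup_eq : Sgroup T R m = Wgroup T R m * Ugroup R m.
Proof.
apply: (@sdprodE _ [group of Wgroup T R m] [group of Ugroup R m]).
  exact: subset_trans Ugroup_bdmat bdmat_norm_Wgroup.
by apply/trivgP; rewrite -Wgroup_bdmat_TI setIS ?Ugroup_bdmat.
Qed.

Lemma bdiag_monover (a : forall i, monomial gT (2 ^ m i)) :
  (forall i, a i \in monover _ TR) -> bdiag a \in monover _ TR.
Proof.
move=> TRa; apply/monoverP=> x; have [i [k ->]] := Rank_sig x.
by rewrite mval_bdiag; have /monoverP := TRa i.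
Qed.

Lemma Sgroup_monover : Sgroup T R m \subset monover _ TR.
Proof.
rewrite Sgroup_eq mul_subG //.
  apply/subsetP=> _ /WgroupP[a wa ->]; apply: bdiag_monover => i.
  by have /setIdP[] := subsetP (wgroup_rdet0 _) _ (wa i).
apply: subset_trans Ugroup_bdmat _; apply/subsetP=> _ /bdmatP[r Rr ->].
by apply: bdiag_monover => i; apply: dmat_monover.
Qed.

Lemma dmon_Sgroup f : (forall i, f i \in T) -> dmon f \in Sgroup T R m.
Proof.
move=> Tf; rewrite Sgroup_eq; apply: (subsetP (mulG_subl _ _)).
rewrite -bdiag_dmon; apply/WgroupP.
exists (fun i => dmon (fun j => f (tagnat.Rank i j))) => // i.
by apply: dmon_wgroup => k; apply: Tf.
Qed.

End MonomialTwoGroups.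

(** * The rank of S(T, R, J) *)

Theorem lemma4p7 (gT : finGroupType) (T R TR : {group gT})
    (n u : nat) (m : 'I_u -> nat) :
  T ><| R = TR ->
  2.-group T ->
  2.-group R ->
  abelian R ->
  (0 < n)%N ->
  {homo m : i j / (i < j)%N} ->
  n = (\sum_(i < u) 2 ^ m i)%N ->
  ((1 < n)%N -> TR :!=: 1) ->
  ('r_2(Sgroup T R m) <= n * 'r_2(TR))%N /\
  ('r_2(T) = 'r_2(TR) -> 'r_2(Sgroup T R m) = (n * 'r_2(T))%N).
Proof.
move=> defTR pT pR abelR _ _ -> ntTR.
have pTR : 2.-group TR by rewrite /pgroup -(sdprod_card defTR) pnatM [X in X && _]pT.
have ub : ('r_2(Sgroup T R m) <= (\sum_(i < u) 2 ^ m i) * 'r_2(TR))%N.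
  apply: leq_trans (p_rankS 2 (Sgroup_monover defTR abelR m)) (p_rank_monover _ _) => //.
  by move=> /ntTR ntTR1; have [] := pgroup_pdiv pTR ntTR1.
split=> // eq_r; apply/eqP; rewrite eqn_leq {1}eq_r ub.
apply: leq_p_rank_dmon => // f Tf; exact: (dmon_Sgroup defTR abelR Tf).
Qed.
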